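(* Let $0<\beta<mn$, let $\vec p=(p_1,\dots,p_m)$ be a vector of exponents, $1\le p_i\le\infty$, and let $\tilde\delta=\beta-n/p$. If $\vec v\in\mathcal H_m(\vec p,\beta,\tilde\delta)$ and $\xi=p/(mp-1)>1$, then $\prod_{i=1}^m v_i^{-1}\in\mathrm{RH}_\xi$.
   Context: Notation. $m\in\mathbb N$; $1/p=\sum_{i=1}^m 1/p_i$; $p_i'$ is the conjugate exponent of $p_i$, so that $1/\xi=m-1/p=\sum_{i=1}^m1/p_i'$; $|B|$ is Lebesgue measure; $w^{-1}(B)=\int_B w^{-1}$. A weight is a locally integrable function $w$ on $\mathbb R^n$ with $0<w(x)<\infty$ for almost every $x$; $\vec v=(v_1,\dots,v_m)$ is a vector of weights. Class of weights. Let $\delta$ be a fixed real number. For a weight $w$ and a vector of weights $\vec v$, $(w,\vec v)\in\mathcal H_m(\vec p,\beta,\tilde\delta)$ means that $w^{-1}$ is locally integrable and there are numbers $\beta_1,\dots,\beta_m$ with $0<\beta_i<n$, $\sum_{i=1}^m\beta_i=\beta$, and a constant $C>0$ such that $$\frac{|B|^{1+(\delta-\tilde\delta)/n}}{w^{-1}(B)}\prod_{i=1}^m\left\|\frac{v_i^{-1}}{(|B|^{1/n}+|x_B-\cdot|)^{n-\beta_i+\delta/m}}\right\|_{p_i'}\le C$$ for every ball $B=B(x_B,R)$. One writes $\vec v\in\mathcal H_m(\vec p,\beta,\tilde\delta)$ when $(w,\vec v)\in\mathcal H_m(\vec p,\beta,\tilde\delta)$ with $w=\prod_{i=1}^m v_i$.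 Reverse Hölder classes. For $1<s<\infty$, a weight $u\in\mathrm{RH}_s$ if there is $C>0$ with $\left(\frac1{|B|}\int_Bu^s\right)^{1/s}\le\frac{C}{|B|}\int_Bu$ for every ball $B$; $u\in\mathrm{RH}_\infty$ if there is $C>0$ with $\sup_Bu\le\frac{C}{|B|}\int_Bu$ for every ball $B$ (essential supremum). *)

(* Defs.v *)
From HB Require Import structures.
From mathcomp Require Import all_boot all_order all_algebra.
From mathcomp Require Import all_classical all_reals all_analysis.
From mathcomp Require Import measurable_realfun ess_sup_inf measurable_structure measure_function measure_extension.

Set Implicit Arguments.
Unset Strict Implicit.
Unset Printing Implicit Defensive.
Import Order.TTheory GRing.Theory Num.Theory.
Import numFieldNormedType.Exports.

Local Open Scope classical_set_scope.
Local Open Scope ring_scope.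
Local Open Scope ereal_scope.

(* Lebesgue measure on the Borel sets of R^n, by induction on n: R^(n+1) is
   R * R^n with the product measure, transported along consp. *)
Section borel_step.
Context {R : realType}.
Local Notation mR := (measurableTypeR R).
Variables (n : nat) (mu : {sigma_finite_measure set (n.-tuple mR) -> \bar R}).

Definition consp (z : mR * n.-tuple mR) : n.+1.-tuple mR := [tuple of z.1 :: z.2].

Lemma measurable_consp : measurable_fun setT consp.
Proof. exact: measurable_cons. Qed.

Definition leb_step : set (n.+1.-tuple mR) -> \bar R :=
  pushforward (@lebesgue_measure R \x mu) consp.

Let mpre A : measurable A -> measurable (consp @^-1` A).
Proof. by move=> mA; rewrite -[X in measurable X]setTI; exact: measurable_consp. Qed.

Let leb_step0 : leb_step set0 = 0.
Proof. by rewrite /leb_step/pushforward preimage_set0 measure0. Qed.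

Let leb_step_ge0 A : 0 <= leb_step A.
Proof. by rewrite /leb_step /pushforward measure_ge0. Qed.

Let leb_step_sigma_additive : semi_sigma_additive leb_step.
Proof.
move=> F mF tF mUF; rewrite /leb_step /pushforward preimage_bigcup.
apply: measure_semi_sigma_additive.
- by move=> i; exact: mpre.
- apply/trivIsetP => /= i j _ _ ij; rewrite -preimage_setI.
  by move/trivIsetP : tF => /(_ _ _ _ _ ij) ->//; rewrite preimage_set0.
- by rewrite -preimage_bigcup; exact: mpre.
Qed.

HB.instance Definition _ := isMeasure.Build _ _ _ leb_step
  leb_step0 leb_step_ge0 leb_step_sigma_additive.

Lemma leb_stepE (A : set mR) (B : set (n.-tuple mR)) :
  measurable A -> measurable B ->
  leb_step [set x | A (thead x) /\ B [tuple of behead x]] = lebesgue_measure A * mu B.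
Proof.
move=> mA mB; rewrite /leb_step /pushforward -product_measure1E//.
congr ((_ \x _) _); apply/seteqP; split=> -[a b] /=;
  have -> : [tuple of behead (consp (a, b))] = b :> n.-tuple mR by exact/val_inj.
- by rewrite theadE.
- by rewrite theadE.
Qed.

Let leb_step_sigma_finite : sigma_finite setT leb_step.
Proof.
have /sigma_finiteP[F [TF ndF Foo]] := sigma_finiteT (@lebesgue_measure R).
have /sigma_finiteP[G [TG ndG Goo]] := sigma_finiteT mu.
exists (fun k => [set x | F k (thead x) /\ G k [tuple of behead x]]).
  apply/esym/seteqP; split => // x _.
  have : [set: mR] (thead x) by []. rewrite TF => -[i _ Fi].
  have : setT [tuple of behead x] by []. rewrite TG => -[j _ Gj].
  exists (maxn i j) => //=; split.
  - by move: Fi; apply/subsetPset/ndF/leq_maxl.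
  - by move: Gj; apply/subsetPset/ndG/leq_maxr.
move=> k; have [mF Fk] := Foo k; have [mG Gk] := Goo k; split; last first.
  by rewrite leb_stepE// lte_mul_pinfty// ge0_fin_numE.
have -> : [set x | F k (thead x) /\ G k [tuple of behead x]] =
    ((fun x => @tnth _ mR x ord0) @^-1` F k) `&`
    ((fun x : n.+1.-tuple mR => [tuple of behead x]) @^-1` G k) by [].
apply: measurableI; rewrite -[X in measurable X]setTI.
- exact: measurable_tnth.
- exact: measurable_behead.
Qed.

HB.instance Definition _ := Measure_isSigmaFinite.Build _ _ _ leb_step
  leb_step_sigma_finite.

End borel_step.

Fixpoint borel_lebesgue (R : realType) (n : nat) :
    {sigma_finite_measure set (n.-tuple (measurableTypeR R)) -> \bar R} :=
  match n with
  | 0%N => \d_ [tuple]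
  | k.+1 => leb_step (borel_lebesgue R k)
  end.

(* R^n with its Lebesgue-measurable sets: the completion of the product
   measure, as completed_lebesgue_measure is in dimension one. *)
Definition Rn (R : realType) (n : nat) : Type :=
  caratheodory_type ((borel_lebesgue R n)^*)%mu.

HB.instance Definition _ (R : realType) (n : nat) := Measurable.copy (Rn R n)
  (caratheodory_type ((borel_lebesgue R n)^*)%mu).

Definition leb (R : realType) (n : nat) : set (Rn R n) -> \bar R :=
  @completed_measure_extension _ _ _ (borel_lebesgue R n).
Arguments leb : clear implicits.

HB.instance Definition _ (R : realType) (n : nat) := Measure.copy (leb R n)
  (@completed_measure_extension _ _ _ (borel_lebesgue R n)).

Section box.
Context {R : realType}.
Local Notation mR := (measurableTypeR R).

Let box n (I : 'I_n -> set mR) : set (n.-tuple mR) :=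
  [set x | forall i, I i (tnth x i)].

Let measurable_box n (I : 'I_n -> set mR) :
  (forall i, measurable (I i)) -> measurable (box I).
Proof.
move=> mI; have -> : box I = \big[setI/setT]_(i < n) ((@tnth _ mR)^~ i @^-1` I i).
  rewrite -bigcap_seq; apply/seteqP; split => x /= xI i; first by move=> _; exact: xI.
  by apply: xI; rewrite /= mem_index_enum.
apply: bigsetI_measurable => i _; rewrite -[X in measurable X]setTI.
exact: measurable_tnth.
Qed.

Let tnth_lift0 n (x : n.+1.-tuple mR) i :
  tnth x (lift ord0 i) = tnth [tuple of behead x] i.
Proof. by rewrite {1}(tuple_eta x) tnthS. Qed.

Lemma leb_box n (I : 'I_n -> set mR) : (forall i, measurable (I i)) ->
  leb R n [set x : n.-tuple mR | forall i, I i (tnth x i)] =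
  \prod_(i < n) lebesgue_measure (I i).
Proof.
move=> mI; transitivity (borel_lebesgue R n (box I)).
  by apply: measurable_mu_extE; exact: measurable_box.
elim: n I mI => [|n ih] I mI; first by rewrite big_ord0 /= diracE mem_set// => -[].
rewrite big_ord_recl -ih// -leb_stepE//; last exact: measurable_box.
congr (leb_step _ _); apply/seteqP; split => x /= xI.
- by split=> [|i]; [|rewrite -tnth_lift0]; exact: xI.
- by case: xI => xI0 xI i; case: (unliftP ord0 i) => [j|] ->//; rewrite tnth_lift0.
Qed.

End box.

Section weights.
Context {R : realType} {n : nat}.
Local Notation mu := (leb R n).

Definition coord (x : Rn R n) (i : 'I_n) : R := tnth (x : n.-tuple R) i.

Definition edist (x y : Rn R n) : R :=
  Num.sqrt (\sum_(i < n) (coord x i - coord y i) ^+ 2).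

Definition eball (x : Rn R n) (r : R) : set (Rn R n) := [set y | edist x y < r]%R.

(* Integrability on every ball is integrability on every compact set. *)
Definition loc_integrable (f : Rn R n -> \bar R) : Prop :=
  measurable_fun setT f /\
  forall (x : Rn R n) (r : R), (0 < r)%R -> mu.-integrable (eball x r) f.

(* Weights are extended-real valued and, like all the hypotheses on them, only
   constrained almost everywhere; 0^-1 = +oo and +oo^-1 = 0 in \bar R. *)
Definition is_weight (w : Rn R n -> \bar R) : Prop :=
  loc_integrable w /\ {ae mu, forall x, 0 < w x < +oo}.

(* sup_B is the essential supremum; extending u by zero outside of B does not
   change it since u is almost everywhere positive. Only meaningful for 1 < s. *)
Definition RH (s : \bar R) (u : Rn R n -> \bar R) : Prop :=
  is_weight u /\
  exists C : R, (0 < C)%R /\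
    forall (x : Rn R n) (r : R), (0 < r)%R ->
      let B := eball x r in
      (if s is t%:E then ((mu B)^-1 * \int[mu]_(y in B) (u y `^ t)) `^ t^-1
       else ess_sup mu (u \_ B))
      <= C%:E / mu B * \int[mu]_(y in B) u y.

Section Hclass.
Variables (m : nat) (delta : R).

Definition Hpair (p : 'I_m -> \bar R) (beta tdelta : R)
    (w : Rn R n -> \bar R) (v : 'I_m -> Rn R n -> \bar R) : Prop :=
  [/\ is_weight w, forall i, is_weight (v i),
      loc_integrable (fun x => (w x)^-1) &
  exists b : 'I_m -> R,
  [/\ forall i, (0 < b i < n%:R)%R, (\sum_(i < m) b i)%R = beta &
  exists C : R, (0 < C)%R /\
    forall (x : Rn R n) (r : R), (0 < r)%R ->
      let B := eball x r in
      mu B `^ (1 + (delta - tdelta) / n%:R) / (\int[mu]_(y in B) (w y)^-1) *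
      \prod_(i < m) Lnorm mu (hoelder_conjugate (p i)) (fun y =>
        (v i y)^-1 /
        (mu B `^ n%:R^-1 + (edist x y)%:E) `^ (n%:R - b i + delta / m%:R))
      <= C%:E]].

(* That the product of the v_i is a weight is part of the condition. *)
Definition Hvec (p : 'I_m -> \bar R) (beta tdelta : R)
    (v : 'I_m -> Rn R n -> \bar R) : Prop :=
  Hpair p beta tdelta (fun x => \prod_(i < m) v i x) v.

End Hclass.

End weights.

(* p with 1/p = \sum_i 1/p_i; it is +oo when every p_i is. *)
Definition total_exponent (R : realType) (m : nat) (p : 'I_m -> \bar R) : \bar R :=
  (\sum_(i < m) (p i)^-1)^-1.

(* Main.v *)
Require Import Defs.
From HB Require Import structures.
From mathcomp Require Import all_boot all_order all_algebra.
From mathcomp Require Import all_classical all_reals all_analysis.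
From mathcomp Require Import ring lra.
From mathcomp Require Import measurable_realfun ess_sup_inf measurable_structure measure_function measure_extension.
Import Order.TTheory GRing.Theory Num.Theory.
Import numFieldNormedType.Exports.

Local Open Scope classical_set_scope.
Local Open Scope ring_scope.
Local Open Scope ereal_scope.

(** The kernels in the condition on [v] reduce to powers of the measure of the
ball once the norms are restricted to the ball itself.  Let [B] be a ball of
radius [r], [b] its measure and [e_i = n - beta_i + delta / m] the exponent of
the [i]-th kernel.  On
[B] the quantity [b^(1/n) + |x - y|] lies between [b^(1/n)] and a dimensional
multiple of it, since [r <= n b^(1/n)]; so [v_i^-1] is at most a constant times
[b^(e_i/n)] times the weighted kernel there, whatever the sign of [e_i]
([trunc_inv_le_kernel]).

The conjugate exponents satisfy [sum_i 1/p_i' = m - 1/p = 1/xi]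
([sum_inv_conjugates], [inv_xi]; the value [xi = +oo] occurs when all [p_i] are
1, and [p = +oo] is excluded by [1 < xi]).  Hoelder's inequality for [m]
functions ([Lnorm_prod_le]) then bounds the [L^xi] norm of [prod_i v_i^-1] over
[B] by the product of the [L^(p_i')] norms of the weighted kernels, times the
power [b^(sum_i e_i / n)] ([Lnorm_prod_trunc_inv_le]).  The condition bounds
this product by a constant times [w^-1(B)] and a power of [b].  As
[sum_i e_i = mn - beta + delta], the powers of [b], including the normalising
factor [b^(-1/xi)], add up to [b^-1], which is the reverse Hoelder inequality.

Hoelder's inequality for several functions is obtained from the weighted
arithmetic-geometric mean inequality ([powR_weighted_AGM]) applied pointwise to
the normalised functions. *)

(** * Norms of finite products of functions *)

Lemma powR_prod (R : realType) (I : finType) (x : I -> R) (t : R) :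
  (forall i, 0 <= x i)%R ->
  ((\prod_i x i) `^ t = \prod_i x i `^ t)%R.
Proof.
move=> x0; suff: ((\prod_i x i) `^ t = \prod_i x i `^ t /\ 0 <= \prod_i x i)%R.
  by case.
elim/big_ind2: _ => [|a b c d [<- b0] [<- d0]|i _].
- by rewrite powR1 ler01.
- by rewrite powRM// mulr_ge0.
- by rewrite x0.
Qed.

(** Weighted arithmetic-geometric mean inequality: with [A] the weighted mean,
multiply the powers of the bounds [a_i / A <= exp (a_i / A - 1)]. *)
Lemma powR_weighted_AGM (R : realType) (I : finType) (l a : I -> R) :
  (forall i, 0 <= l i)%R -> (forall i, 0 <= a i)%R -> (\sum_i l i = 1)%R ->
  (\prod_i a i `^ l i <= \sum_i l i * a i)%R.
Proof.
move=> l0 a0 l1; set A := (\sum_i l i * a i)%R.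
have la0 i : (0 <= l i * a i)%R by rewrite mulr_ge0.
have [A0|A0] := eqVneq A 0%R.
  rewrite A0; have /psumr_eq0P la : (\sum_i l i * a i = 0)%R by [].
  have [i li0] : exists i, l i != 0%R.
    apply/existsP; rewrite -negb_forall; apply/negP => /forallP l_0.
    move: l1; rewrite big1 => [/eqP|i _]; first by rewrite eq_sym oner_eq0.
    exact/eqP.
  rewrite (bigD1 i)//= (_ : a i = 0%R) ?powR0 ?mul0r//.
  have /eqP := la (fun i _ => la0 i) i erefl.
  by rewrite mulf_eq0 (negPf li0) => /eqP.
have Agt0 : (0 < A)%R by rewrite lt_neqAle eq_sym A0 sumr_ge0.
have AE : (A = \prod_i A `^ l i)%R.
  rewrite -[LHS](powRr1 (ltW Agt0)) -l1.
  elim/big_rec2: _ => [|i y s _ <-]; first by rewrite powRr0.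
  by rewrite powRD// A0 implybT.
have -> : (\prod_i a i `^ l i = A * \prod_i (a i / A) `^ l i)%R.
  rewrite [X in (X * _)%R]AE -big_split/=; apply: eq_bigr => i _.
  by rewrite -powRM ?divr_ge0 ?(ltW Agt0)// mulrCA divff// mulr1.
rewrite -[leRHS]mulr1 ler_pM2l//.
apply: (@le_trans _ _ (\prod_i expR ((a i / A - 1) * l i))%R).
  apply: ler_prod => i _; rewrite powR_ge0/= expRM.
  rewrite ge0_ler_powR ?nnegrE ?expR_ge0 ?divr_ge0 ?(ltW Agt0)//.
  by rewrite -[leLHS](subrK 1%R) addrC expR_ge1Dx.
rewrite -expR_sum.
under eq_bigr do rewrite mulrBl mul1r mulrAC [(a _ * _)%R]mulrC.
by rewrite sumrB l1 -mulr_suml -/A divff// subrr expR0.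
Qed.

Lemma prode_gt0 (R : realType) (I : finType) (P : pred I) (x : I -> \bar R) :
  (forall i, 0 < x i) -> 0 < \prod_(i | P i) x i.
Proof. by move=> x0; elim/big_ind: _ => // a b; exact: mule_gt0. Qed.

Lemma le_Lnorm d (T : measurableType d) (R : realType)
    (mu : {measure set T -> \bar R}) (p : \bar R) (f g : T -> \bar R) :
  0 < p -> measurable_fun setT f -> measurable_fun setT g ->
  {ae mu, forall x, `|f x| <= `|g x|} -> Lnorm mu p f <= Lnorm mu p g.
Proof.
move=> + mf mg fg; rewrite unlock; case: p => [r|_|//].
  rewrite lte_fin => r0; apply: gt0_ler_poweR.
  - by rewrite invr_ge0 ltW.
  - by rewrite in_itv/= leey integral_ge0// => x _; exact: poweR_ge0.
  - by rewrite in_itv/= leey integral_ge0// => x _; exact: poweR_ge0.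
  apply: ae_ge0_le_integral => //.
  - by move=> x _; exact: poweR_ge0.
  - by apply: (measurableT_comp (measurable_poweR r)); exact: measurableT_comp.
  - by move=> x _; exact: poweR_ge0.
  - by apply: (measurableT_comp (measurable_poweR r)); exact: measurableT_comp.
  apply: filterS fg => x fgx _; apply: gt0_ler_poweR => //; first exact: ltW.
  - by rewrite in_itv/= leey andbT.
  - by rewrite in_itv/= leey andbT.
by case: ifPn => // _; exact: le_ess_sup.
Qed.

Lemma Lnorm_pZl d (T : measurableType d) (R : realType)
    (mu : {measure set T -> \bar R}) (p : \bar R) (k : R) (f : T -> \bar R) :
  0 < p -> (0 < k)%R -> measurable_fun setT f ->
  Lnorm mu p (fun x => k%:E * f x) = k%:E * Lnorm mu p f.
Proof.
move=> + k0 mf; have kf x : `|k%:E * f x| = k%:E * `|f x|.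
  by rewrite abseM/= gtr0_norm.
rewrite unlock; case: p => [r|_|//].
  rewrite lte_fin => r0.
  under eq_integral do rewrite kf poweRM// ?lee_fin ?(ltW k0)//.
  rewrite ge0_integralZl_EFin//; last 3 first.
  - by move=> x _; exact: poweR_ge0.
  - by apply: (measurableT_comp (measurable_poweR r)); exact: measurableT_comp.
  - exact: powR_ge0.
  rewrite poweRM ?lee_fin ?powR_ge0//; last first.
    by rewrite integral_ge0// => x _; exact: poweR_ge0.
  by rewrite -poweR_EFin -poweRrM divff ?gt_eqF// poweRe1// lee_fin ltW.
case: ifPn => _; last by rewrite mule0.
by rewrite -ess_sup_pZl//; congr ess_sup; apply/funext => x /=; rewrite kf.
Qed.

(** Hoelder's inequality for finitely many functions and positive,
possibly infinite, exponents.  The reciprocal [s i] of [q i] is a real number, zero when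
[q i = +oo], so that [+oo] is handled together with the finite exponents. *)
Section hoelder_prod.
Context d (T : measurableType d) (R : realType) (mu : {measure set T -> \bar R}).
Variables (I : finType) (f : I -> T -> R) (q : I -> \bar R) (t : \bar R).
Hypothesis mf : forall i, measurable_fun setT (f i).
Hypothesis q0 : forall i, 0 < q i.
Hypothesis qt : \sum_i (q i)^-1 = t^-1.

Let F i := EFin \o f i.
Let N i := Lnorm mu (q i) (F i).
Let s i := fine (q i)^-1.

Let qs i : (q i)^-1 = (s i)%:E.
Proof. by rewrite /s fineK// fin_numV ?gt_eqF// (lt_trans _ (q0 i)). Qed.

Let s0 i : (0 <= s i)%R.
Proof. by rewrite -lee_fin -qs inve_ge0 ltW. Qed.

Let qy i : s i = 0%R -> q i = +oo.
Proof. by move=> si; apply/eqP; rewrite -inve_eq0 qs si. Qed.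

Let qfin i : s i != 0%R -> q i = ((s i)^-1)%:E.
Proof. by move=> si; rewrite -[q i]inveK qs inver (negPf si). Qed.

(** The case of positive finite norms [M i]: for a finite exponent [r], the
mean inequality with weights [r s_i] is applied pointwise to
[(|f_i| / M_i)^(1/s_i)] and integrated. *)
Lemma Lnorm_prod_fin : (forall i, 0 < N i < +oo) ->
  Lnorm mu t (EFin \o (fun x => \prod_i f i x)%R) <= \prod_i N i.
Proof.
move=> N0y.
have [M NM] : exists M : I -> R, forall i, N i = (M i)%:E.
  exists (fine \o N) => i; rewrite /= fineK// ge0_fin_numE.
    by case/andP: (N0y i).
  by case/andP: (N0y i) => /ltW.
have M0 i : (0 < M i)%R by rewrite -lte_fin -NM; case/andP: (N0y i).
have M1 i : s i = 0%R -> {ae mu, forall x, (`|f i x| <= M i)%R}.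
  move=> si; have := NM i; rewrite /N (qy i si) unlock.
  case: ifPn => [_ NMi|_ [M_0]]; last by have := M0 i; rewrite -M_0 ltxx.
  have := ess_sup_ge mu (abse \o F i); rewrite NMi.
  by apply: filterS => x; rewrite /= lee_fin.
rewrite (eq_bigr (EFin \o M)) => [|i _]; last by rewrite NM.
rewrite prodEFin.
have Mp0 : (0 <= \prod_i M i)%R by apply: prodr_ge0 => i _; exact/ltW.
have sumsE : (\sum_i s i)%R%:E = t^-1.
  by rewrite -qt -sumEFin; apply: eq_bigr => i _; rewrite qs.
have [t_oo|tNy] := eqVneq t +oo.
  have s_0 i : s i = 0%R.
    move: sumsE; rewrite t_oo invey => -[] /psumr_eq0P; apply => // j _.
  rewrite t_oo unlock; case: ifPn => [_|_]; last by rewrite lee_fin.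
  apply/ess_supP.
  have : {ae mu, forall x i, (`|f i x| <= M i)%R}.
    by apply: filter_forall => i; exact/M1/s_0.
  apply: filterS => x fM; rewrite /= lee_fin normr_prod.
  by apply: ler_prod => i _; rewrite normr_ge0 fM.
have sum0 : (0 < \sum_i s i)%R.
  rewrite lt_neqAle sumr_ge0// andbT; apply: contra_neq tNy => sum_0.
  by rewrite -[t]inveK -sumsE -sum_0 inve0.
have {tNy sumsE} [r [r0 tr rs]] :
    exists r, [/\ (0 < r)%R, t = r%:E & (\sum_i r * s i = 1)%R].
  exists (\sum_i s i)^-1%R; split; first by rewrite invr_gt0.
    by rewrite -[t]inveK -sumsE inver gt_eqF.
  by rewrite -mulr_sumr mulVf// gt_eqF.
(* When [q i = +oo] the weight [r * s i] vanishes, and the value 1 dominates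
   [|f i x| / M i] almost everywhere. *)
pose a i x := (if s i == 0 then 1 else (`|f i x| / M i) `^ (s i)^-1)%R.
have a0 i x : (0 <= a i x)%R by rewrite /a; case: ifP => // _; exact: powR_ge0.
have rs0 i : (0 <= r * s i)%R by rewrite mulr_ge0// ltW.
have mfM i : measurable_fun setT (fun x => (`|f i x| / M i)%R).
  by apply: measurable_funM => //; exact: measurableT_comp.
have ma i : measurable_fun setT (a i).
  rewrite /a; case: eqP => // _.
  exact: (measurableT_comp (measurable_powR (s i)^-1) (mfM i)).
(* Each term of the weighted mean integrates to at most its weight. *)
have int_a i : \int[mu]_x (r * s i * a i x)%:E <= (r * s i)%:E.
  have [si|si] := eqVneq (s i) 0%R.
    under eq_integral do rewrite si mulr0 mul0r.
    by rewrite integral0 si mulr0.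
  rewrite -[leRHS]mule1.
  under eq_integral do rewrite EFinM.
  rewrite ge0_integralZl_EFin//; last 2 first.
    by move=> x _; rewrite lee_fin.
    exact/measurable_EFinP.
  rewrite lee_wpmul2l ?lee_fin//.
  have /(congr1 (fun z => poweR z (s i)^-1%R)) := NM i.
  rewrite /N (qfin i si) poweR_Lnorm ?invr_eq0//= => NiE.
  have Mi : (0 < M i `^ (s i)^-1)%R by exact: powR_gt0.
  rewrite (eq_integral
    (fun x => ((M i `^ (s i)^-1)^-1)%R%:E * (`|F i x| `^ (s i)^-1%R))).
    rewrite ge0_integralZl_EFin//; last 3 first.
    - by move=> x _; exact: poweR_ge0.
    - apply: (measurableT_comp (measurable_poweR _)).
      by apply: measurableT_comp => //; exact/measurable_EFinP.
    - by rewrite invr_ge0 ltW.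
    by rewrite NiE -EFinM mulVf// gt_eqF.
  move=> x _; rewrite /= -EFinM /a (negPf si); congr EFin.
  by rewrite powRM// ?invr_ge0 ?(ltW (M0 i))// mulrC -powR_inv1 ?(ltW (M0 i))//
    powRAC powR_inv1// ltW.
rewrite tr unlock.
rewrite (_ : (\prod_i M i)%R%:E = ((\prod_i M i) `^ r)%:E `^ r^-1); last first.
  by rewrite -poweR_EFin -poweRrM divff ?gt_eqF// poweRe1// lee_fin.
have Mr0 : (0 <= (\prod_i M i) `^ r)%R by exact: powR_ge0.
apply: gt0_ler_poweR.
- by rewrite invr_ge0 ltW.
- by rewrite in_itv/= leey integral_ge0// => x _; exact: poweR_ge0.
- by rewrite in_itv/= leey andbT lee_fin.
apply: (@le_trans _ _
  (\int[mu]_x (((\prod_i M i) `^ r)%:E * \sum_i (r * s i * a i x)%:E))).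
  apply: ae_ge0_le_integral => //.
  - by move=> x _; exact: poweR_ge0.
  - apply: (measurableT_comp (measurable_poweR r)).
    apply: measurableT_comp => //; apply/measurable_EFinP.
    exact: measurable_prod.
  - move=> x _; rewrite mule_ge0 ?sume_ge0 ?lee_fin// => i _.
    by rewrite lee_fin mulr_ge0.
  - apply: measurable_funeM; apply: emeasurable_sum => i.
    by apply/measurable_EFinP; exact: measurable_funM.
  have : {ae mu, forall x i, s i = 0%R -> (`|f i x| <= M i)%R}.
    apply: filter_forall => i; have [si|si] := eqVneq (s i) 0%R.
      by apply: filterS (M1 i si) => x + _.
    by apply: nearW => x si0; rewrite si0 eqxx in si.
  apply: filterS => x fM _.
  rewrite sumEFin -EFinM /= lee_fin normr_prod.
  apply: (@le_trans _ _
    ((\prod_i M i) `^ r * \prod_i a i x `^ (r * s i))%R); last first.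
    by rewrite ler_wpM2l// powR_weighted_AGM.
  rewrite !powR_prod//; last by move=> i; rewrite ltW.
  rewrite -big_split/=; apply: ler_prod => i _; rewrite powR_ge0/= /a.
  case: ifPn => [/eqP si|si].
    rewrite powR1 mulr1 ge0_ler_powR ?nnegrE ?(ltW r0) ?(ltW (M0 i))//.
    exact: fM.
  rewrite -powRrM mulrCA mulVf// mulr1 -powRM ?(ltW (M0 i))//; last first.
    by rewrite divr_ge0// ltW.
  by rewrite mulrCA divff ?gt_eqF// mulr1.
rewrite ge0_integralZl_EFin//; last 2 first.
  by move=> x _; rewrite sume_ge0// => i _; rewrite lee_fin mulr_ge0.
  by apply: emeasurable_sum => i; apply/measurable_EFinP; exact: measurable_funM.
rewrite ge0_integral_sum//; last 2 first.
  by move=> i; apply/measurable_EFinP; exact: measurable_funM.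
  by move=> i x _; rewrite lee_fin mulr_ge0.
rewrite -[leRHS]mule1 lee_wpmul2l// -rs -sumEFin.
by apply: lee_sum => i _; exact: int_a.
Qed.

(** A factor of norm zero vanishes almost everywhere, so the inequality also
holds when the right-hand side is the product of zero and infinite norms. *)
Lemma Lnorm_prod_le :
  Lnorm mu t (EFin \o (fun x => \prod_i f i x)%R) <=
  \prod_i Lnorm mu (q i) (EFin \o f i).
Proof.
rewrite -[leRHS]/(\prod_i N i).
have t0 : 0 < t.
  have tV : 0 <= t^-1 by rewrite -qt sume_ge0// => i _; rewrite inve_ge0 ltW.
  rewrite lt_neqAle eq_sym -inve_ge0 tV andbT -inve_eqy -qt.
  rewrite (eq_bigr (EFin \o s)) => [|i _]; last by rewrite qs.
  by rewrite sumEFin.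
have N0 i : 0 <= N i by exact: Lnorm_ge0.
have [[i Ni0]|Nn0] := pselect (exists i, N i = 0).
  have fi0 : F i = \0 %[ae mu].
    by apply: (Lnorm_eq0_eq0 _ (q0 i) Ni0); exact/measurable_EFinP.
  rewrite (bigD1 i)//= Ni0 mul0e -(Lnorm0 mu (negbT (gt_eqF t0))).
  apply: le_Lnorm => //; first exact/measurable_EFinP/measurable_prod.
  apply: filterS fi0 => x /(_ Logic.I) [fix0]; rewrite /= (bigD1 i)//= fix0 mul0r.
  by rewrite normr0.
have Ngt0 i : 0 < N i.
  by rewrite lt_neqAle N0 andbT eq_sym; apply/eqP => Ni; apply: Nn0; exists i.
have [[i Niy]|Nny] := pselect (exists i, N i = +oo).
  by rewrite (bigD1 i)//= Niy gt0_mulye ?leey// prode_gt0.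
apply: Lnorm_prod_fin => i; rewrite Ngt0 lt_neqAle leey andbT.
by apply/eqP => Ni; apply: Nny; exists i.
Qed.
End hoelder_prod.

(** * Conjugate exponents *)

Section exponents.
Context {R : realType} {m : nat}.
Variable p : 'I_m -> \bar R.
Hypothesis p1 : forall i, 1 <= p i.

Lemma sum_inv_exponents :
  exists2 S : R, (0 <= S <= m%:R)%R & \sum_(i < m) (p i)^-1 = S%:E.
Proof.
have p0 i : 0 < p i by exact: lt_le_trans (p1 i).
have pV i : 0 <= (p i)^-1 <= 1.
  by rewrite inve_ge0 (ltW (p0 i))/= inve_ple ?inve1// inE ?lee01//; exact/ltW.
exists (\sum_(i < m) fine (p i)^-1)%R; last first.
  rewrite -sumEFin; apply: eq_bigr => i _; rewrite fineK// fin_numV ?gt_eqF//.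
  exact: lt_trans (p0 i).
have pf i : (0 <= fine (p i)^-1 <= 1)%R.
  have := pV i; rewrite -{1 2}[(p i)^-1]fineK ?lee_fin//.
  by rewrite fin_numV ?gt_eqF// (lt_trans _ (p0 i)).
rewrite sumr_ge0/=; last by move=> i _; case/andP: (pf i).
rewrite -[X in (_ <= X%:R)%R]card_ord -sumr_const; apply: ler_sum => i _.
by case/andP: (pf i).
Qed.

Lemma sum_inv_conjugates (S : R) : \sum_(i < m) (p i)^-1 = S%:E ->
  \sum_(i < m) (hoelder_conjugate (p i))^-1 = (m%:R - S)%:E.
Proof.
move=> pS; have p0 i : 0 < p i by exact: lt_le_trans (p1 i).
have pVfin i : (p i)^-1 \is a fin_num.
  by rewrite fin_numV ?gt_eqF// (lt_trans _ (p0 i)).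
rewrite (eq_bigr (fun i => (1 - fine (p i)^-1)%R%:E)) => [|i _]; last first.
  rewrite EFinB fineK// -(@hoelder_conjugate_eq1 _ (p i)) ?gt_eqF//.
    by rewrite addeAC subee ?add0e.
  exact: lt_trans (p0 i).
rewrite sumEFin sumrB sumr_const card_ord; congr (_ - _)%:E.
apply/EFin_inj; rewrite -pS -sumEFin; apply: eq_bigr => i _.
by rewrite fineK.
Qed.

(** When the sum [S] of the inverse exponents vanishes, the total exponent is
[+oo] and the quotient [xi] is [+oo / +oo = 0], contradicting [1 < xi].  When
[S = m] the denominator is zero and [xi = +oo], with inverse [0 = m - S]. *)
Lemma inv_xi (S : R) (ptot := total_exponent p)
    (xi := ptot / (m%:R%:E * ptot - 1)) :
  \sum_(i < m) (p i)^-1 = S%:E -> (0 <= S <= m%:R)%R -> 1 < xi ->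
  [/\ (0 < S)%R, ptot = S^-1%:E & xi^-1 = (m%:R - S)%:E].
Proof.
move=> pS /andP[S0 Sm]; rewrite /xi /ptot /total_exponent pS inver.
case: eqVneq => [->|Sn0].
  have [->|m0] := posnP m.
    by rewrite mul0e add0e inveN// inve1 muleN mule1 ltNge leNye.
  by rewrite gt0_muley ?lte_fin ?ltr0n// addye// invey mule0 ltNge lee01.
have {}S0 : (0 < S)%R by rewrite lt_neqAle eq_sym Sn0.
rewrite -EFinM -EFinB inver.
have mS : (m%:R / S - 1 = (m%:R - S) / S)%R by field.
rewrite mS mulf_eq0 invr_eq0 (negPf Sn0) orbF.
case: eqVneq => [mS0|mS0].
  by rewrite gt0_muley ?lte_fin ?invr_gt0// invey mS0.
rewrite -EFinM => _; split => //; rewrite inver.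
have -> : (S^-1 * ((m%:R - S) / S)^-1 = (m%:R - S)^-1)%R.
  by field; apply/andP.
by rewrite invr_eq0 (negPf mS0) invrK.
Qed.

End exponents.

(** * Products and inverses of extended real functions *)

Lemma measurable_inve (R : realType) :
  measurable_fun [set: \bar R] (fun x : \bar R => x^-1).
Proof.
have -> : (fun x : \bar R => x^-1) =
    (fun x => if x == 0 then +oo else if x == -oo then -oo else
       (fine x)^-1%R%:E).
  apply/funext => x; case: (inveP x) => [|||r r0]; rewrite ?eqxx//=.
    by rewrite invr0.
  by rewrite eqe (negPf r0).
apply: measurable_fun_ifT => //; first exact: measurable_fun_eqe.
apply: measurable_fun_ifT => //; first exact: measurable_fun_eqe.
apply/measurable_EFinP.
(* [y^-1 = (y^2)^(-1) * y] also holds at 0, and expresses the inverse by the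
   measurable power function on nonnegative reals. *)
have -> : (fun x => (fine x)^-1)%R =
    (fun x : \bar R => (fine x ^+ 2) `^ (-1) * fine x)%R.
  apply/funext => x; rewrite powR_inv1 ?sqr_ge0//.
  have [->|x0] := eqVneq (fine x) 0%R; first by rewrite invr0 mulr0.
  by rewrite expr2 invfM -mulrA mulVf// mulr1.
apply: measurable_funM => //.
apply: (measurableT_comp (measurable_powR _)).
exact: measurable_funX.
Qed.

Lemma emeasurable_prod d (T : measurableType d) (R : realType) (D : set T)
    (I : Type) (s : seq I) (h : I -> T -> \bar R) :
  (forall i, measurable_fun D (h i)) ->
  measurable_fun D (fun x => \prod_(i <- s) h i x).
Proof.
move=> mh; elim: s => [|i s ih].
  by under eq_fun do [rewrite big_nil]; exact: measurable_cst.
under eq_fun do rewrite big_cons.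
exact: emeasurable_funM.
Qed.

Lemma lee_prod_ge0 (R : realType) (I : finType) (x y : I -> \bar R) :
  (forall i, 0 <= x i <= y i) -> \prod_i x i <= \prod_i y i.
Proof.
move=> xy; suff : 0 <= \prod_i x i <= \prod_i y i by case/andP.
elim/big_ind2: _ => [|a b c d /andP[a0 ab] /andP[c0 cd]|i _]; last exact: xy.
  by rewrite lee01 lexx.
by rewrite mule_ge0//= lee_pmul.
Qed.

Lemma ae_integral_ge0 d (T : measurableType d) (R : realType)
    (mu : {measure set T -> \bar R}) (D : set T) (f : T -> \bar R) :
  measurable D -> measurable_fun D f -> {ae mu, forall x, 0 <= f x} ->
  0 <= \int[mu]_(x in D) f x.
Proof.
move=> mD mf f0; rewrite (@ae_eq_integral _ _ _ mu D (fun x => `|f x|))//.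
- exact: integral_ge0.
- exact: measurableT_comp.
- by apply: filterS f0 => x fx0 _; rewrite gee0_abs.
Qed.

(** Division in a bound by [C%:E]; [W] may be 0, in which case [W^-1 = +oo]
forces [N = 0], or [+oo]. *)
Lemma le_of_ratio_le (R : realType) (c C : R) (W N : \bar R) :
  (0 < c)%R -> (0 < C)%R -> 0 <= W -> 0 <= N -> c%:E / W * N <= C%:E ->
  N <= (C / c)%R%:E * W.
Proof.
move=> c0 C0 W0 N0; have Cc : 0 < (C / c)%R%:E by rewrite lte_fin divr_gt0.
case: W W0 => [w|_ _|//]; last by rewrite gt0_muley// leey.
rewrite lee_fin le_eqVlt => /predU1P[<-|w0].
  rewrite inve0 gt0_muley// mule0.
  move: N0; rewrite le_eqVlt => /predU1P[<-//|N0].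
  by rewrite gt0_mulye// leye_eq.
rewrite inver gt_eqF// -EFinM -lee_pdivlMl ?divr_gt0// => /le_trans; apply.
rewrite -EFinM lee_fin le_eqVlt; apply/orP; left; apply/eqP.
by field; rewrite !gt_eqF.
Qed.

(** * Balls of R^n *)

Section Rn_theory.
Context {R : realType} {n : nat}.
Local Notation mu := (leb R n).

Lemma measurable_coord i : measurable_fun setT (@Defs.coord R n ^~ i).
Proof.
move=> _ A mA; rewrite setTI.
apply: sub_caratheodory; apply: sub_sigma_algebra.
rewrite -[X in measurable X]setTI.
exact: (@measurable_tnth _ _ n i measurableT A mA).
Qed.

Lemma measurable_edist x : measurable_fun setT (@Defs.edist R n x).
Proof.
have ms : measurable_fun setT
    (fun y : Rn R n => \sum_(i < n) (Defs.coord x i - Defs.coord y i) ^+ 2)%R.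
  apply: (@measurable_sum _ (Rn R n) R setT 'I_n _
    (fun i y => (Defs.coord x i - Defs.coord y i) ^+ 2)%R) => i.
  apply: measurable_funX; apply: measurable_funB; first exact: measurable_cst.
  exact: measurable_coord.
have msqrt : measurable_fun [set: R] (@Num.sqrt R).
  by apply: continuous_measurable_fun; exact: sqrt_continuous.
exact: (measurableT_comp msqrt ms).
Qed.

Lemma measurable_eball (x : Rn R n) (r : R) : measurable (eball x r).
Proof.
rewrite -[X in measurable X]setTI.
have := measurable_edist x measurableT _ (measurable_itv `]-oo, r[).
by rewrite (_ : _ @^-1` _ = eball x r).
Qed.

Lemma edist_ge0 (x y : Rn R n) : (0 <= Defs.edist x y)%R.
Proof. exact: sqrtr_ge0. Qed.

Lemma coord_le_edist (x y : Rn R n) i :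
  (`|Defs.coord x i - Defs.coord y i| <= Defs.edist x y)%R.
Proof.
rewrite -sqrtr_sqr ler_wsqrtr// (bigD1 i)//= lerDl sumr_ge0// => j _.
exact: sqr_ge0.
Qed.

Lemma leb_cube (x : Rn R n) (r : R) : (0 <= r)%R ->
  mu [set y : n.-tuple R | forall i, (`|Defs.coord x i - tnth y i| < r)%R] =
  ((2 * r) ^+ n)%:E.
Proof.
move=> r0.
pose J i := `](Defs.coord x i - r)%R, (Defs.coord x i + r)%R[%classic.
rewrite (_ : [set _ | _] = [set y : n.-tuple R | forall i, J i (tnth y i)]).
  rewrite leb_box; last by move=> i; exact: measurable_itv.
  rewrite (eq_bigr (fun=> (2 * r)%R%:E)) => [|i _].
    by rewrite prodEFin prodr_const card_ord.
  rewrite lebesgue_measure_itv/= lte_fin.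
  rewrite ltrBlDr -addrA ltrDl.
  case: ifPn => [_|]; first by rewrite -EFinD; congr EFin; ring.
  rewrite -leNgt => r2; congr EFin; lra.
apply/seteqP; split => y /= yJ i; have := yJ i; rewrite /J/= in_itv/= ltr_distlC.
  by move=> /andP[a b]; apply/andP; split; lra.
by move=> /andP[a b]; apply/andP; split; lra.
Qed.

Lemma measurable_cube (x : Rn R n) (r : R) :
  measurable
    [set y : Rn R n | forall i, (`|Defs.coord x i - Defs.coord y i| < r)%R].
Proof.
have -> :
    [set y : Rn R n | forall i, (`|Defs.coord x i - Defs.coord y i| < r)%R] =
    \bigcap_(i in [set: 'I_n])
      [set y | (`|Defs.coord x i - Defs.coord y i| < r)%R].
  by apply/seteqP; split => y /= H i => [_|]; apply: H.
apply: fin_bigcap_measurable => [|i _]; first exact: finite_finset.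
rewrite -[X in measurable X]setTI.
have mf : measurable_fun setT
    (fun y : Rn R n => `|Defs.coord x i - Defs.coord y i|%R).
  have mB : measurable_fun setT
      (fun y : Rn R n => Defs.coord x i - Defs.coord y i)%R.
    apply: measurable_funB; first exact: measurable_cst.
    exact: measurable_coord.
  exact: (measurableT_comp (@normr_measurable R setT) mB).
have := mf measurableT _ (measurable_itv `]-oo, r[).
by rewrite (_ : _ @^-1` _ =
  [set y : Rn R n | (`|Defs.coord x i - Defs.coord y i| < r)%R]).
Qed.

Lemma leb_eball_le (x : Rn R n) (r : R) : (0 < r)%R ->
  mu (eball x r) <= ((2 * r) ^+ n)%:E.
Proof.
move=> r0; rewrite -(leb_cube x _ (ltW r0)); apply: le_measure; rewrite ?inE.
- exact: measurable_eball.
- exact: measurable_cube.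
- by move=> y xy i; exact: le_lt_trans (coord_le_edist x y i) xy.
Qed.

(** The ball contains the cube of half-side [r / n], as [n (r / n)^2 <= r^2]. *)
Lemma leb_eball_ge (x : Rn R n) (r : R) : (0 < n)%N -> (0 < r)%R ->
  ((2 * (r / n%:R)) ^+ n)%:E <= mu (eball x r).
Proof.
move=> n0 r0; have n0R : (0 < n%:R :> R)%R by rewrite ltr0n.
have rn0 : (0 < r / n%:R)%R by rewrite divr_gt0.
rewrite -(leb_cube x _ (ltW rn0)); apply: le_measure; rewrite ?inE.
- exact: measurable_cube.
- exact: measurable_eball.
move=> y xy; rewrite /eball/= /Defs.edist.
rewrite -[ltRHS]gtr0_norm// -sqrtr_sqr ltr_sqrt ?exprn_gt0//.
apply: (@lt_le_trans _ _ (\sum_(i < n) (r / n%:R) ^+ 2)%R).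
  apply: ltr_sum => [|i _].
    by apply/hasP; exists (Ordinal n0); rewrite ?mem_index_enum.
  by rewrite -real_normK ?num_real// ltrXn2r// xy.
rewrite sumr_const card_ord -[leLHS]mulr_natr expr_div_n -mulrA.
rewrite ler_piMr ?sqr_ge0//.
by rewrite expr2 invfM -mulrA mulVf ?gt_eqF// mulr1 invf_le1// ler1n.
Qed.

(** The measure [b] of a ball is positive and finite, and [b^(1/n)] controls its
radius. *)
Lemma leb_eball_fin (x : Rn R n) (r : R) :
  (0 < n)%N -> (0 < r)%R ->
  exists b : R, [/\ (0 < b)%R, mu (eball x r) = b%:E &
    (r <= n%:R * b `^ n%:R^-1)%R].
Proof.
move=> n0 r0; have := leb_eball_le x r r0; have := leb_eball_ge x r n0 r0.
have n0R : (0 < n%:R :> R)%R by rewrite ltr0n.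
have rn0 : (0 < 2 * (r / n%:R))%R by rewrite mulr_gt0// divr_gt0.
case: (mu _) => [b|//|//]; rewrite !lee_fin => rb _.
have b0 : (0 < b)%R by apply: lt_le_trans rb; rewrite exprn_gt0.
exists b; split => //.
apply: (@le_trans _ _ (n%:R * (2 * (r / n%:R)))%R).
  have -> : (n%:R * (2 * (r / n%:R)) = 2 * r)%R.
    by field; rewrite gt_eqF.
  lra.
rewrite ler_pM2l//; set c := (2 * (r / n%:R))%R in rb rn0 *.
have -> : c = ((c ^+ n) `^ n%:R^-1)%R.
  by rewrite -powR_mulrn ?(ltW rn0)// -powRrM divff ?gt_eqF// powRr1// ltW.
rewrite ge0_ler_powR ?nnegrE ?invr_ge0 ?(ltW n0R) ?(ltW b0)//.
by rewrite exprn_ge0// ltW.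
Qed.

End Rn_theory.

(** * Weights on a ball *)

(** The exponent [e] may have any sign: for [e < 0] the lower bound [x <= z] is
the one that matters. *)
Lemma powR_le_scale (R : realType) (x z k e : R) :
  (0 < x)%R -> (x <= z <= k * x)%R -> (1 <= k)%R ->
  (z `^ e <= k `^ `|e| * x `^ e)%R.
Proof.
move=> x0 /andP[xz zk] k1.
have k0 : (0 < k)%R by exact: lt_le_trans k1.
have z0 : (0 < z)%R by exact: lt_le_trans xz.
have [xn zn kn] : [/\ 0 <= x, 0 <= z & 0 <= k]%R by split; exact: ltW.
have [e0|e0] := leP 0%R e.
  rewrite ger0_norm// -powRM//.
  by rewrite ge0_ler_powR ?nnegrE ?mulr_ge0.
have ke : (1 <= k `^ `|e|)%R by rewrite -[leLHS](powRr0 k) ler_powR.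
apply: (@le_trans _ _ (x `^ e)%R); last by rewrite ler_peMl ?powR_ge0.
rewrite -[e]opprK (powRN z) (powRN x) lef_pV2 ?posrE ?powR_gt0//.
by rewrite ge0_ler_powR ?nnegrE ?oppr_ge0 ?(ltW e0).
Qed.

Section weights_on_a_ball.
Context {R : realType} {n m : nat}.
Local Notation mu := (leb R n).
Variable v : 'I_m -> Rn R n -> \bar R.
Hypothesis wv : forall i, is_weight (v i).

Let mv i : measurable_fun setT (v i).
Proof. by case: (wv i) => -[]. Qed.

Let mvV i : measurable_fun setT (fun x => (v i x)^-1).
Proof. exact: (measurableT_comp (@measurable_inve R) (mv i)). Qed.

(** Off a null set all the weights are positive reals; there, inverses and products of
weights are those of real numbers. *)
Lemma ae_weights_pos :
  {ae mu, forall x, exists2 a : 'I_m -> R, (forall i, 0 < a i)%R &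
    forall i, v i x = (a i)%:E}.
Proof.
have : {ae mu, forall x i, 0 < v i x < +oo}.
  by apply: filter_forall => i; case: (wv i).
apply: filterS => x vx; exists (fun i => fine (v i x)) => i;
  by have /andP[] := vx i; case: (v i x).
Qed.

Lemma measurable_prod_inv :
  measurable_fun setT (fun x => \prod_(i < m) (v i x)^-1).
Proof. exact: emeasurable_prod. Qed.

Lemma ae_inv_prod :
  {ae mu, forall x, (\prod_(i < m) v i x)^-1 = \prod_(i < m) (v i x)^-1}.
Proof.
apply: filterS ae_weights_pos => x [a a0 va].
rewrite (eq_bigr (fun i => (a i)%:E)); last by move=> i _; rewrite va.
rewrite [RHS](eq_bigr (fun i => (a i)^-1%:E)); last first.
  by move=> i _; rewrite va inver gt_eqF.
by rewrite !prodEFin inver prodfV gt_eqF// prodr_gt0.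
Qed.

Lemma is_weight_prod_inv :
  loc_integrable (fun x => (\prod_(i < m) v i x)^-1) ->
  is_weight (fun x => \prod_(i < m) (v i x)^-1).
Proof.
move=> [mw iw]; split; first split.
- exact: measurable_prod_inv.
- move=> x r r0; have /integrableP[_ wfin] := iw x r r0.
  apply/integrableP; split; first exact: measurable_funS measurable_prod_inv.
  apply: le_lt_trans wfin; rewrite le_eqVlt; apply/orP; left; apply/eqP.
  apply: ae_eq_integral.
  + exact: measurable_eball.
  + apply: (measurableT_comp (@abse_measurable R setT)).
    exact: measurable_funS measurable_prod_inv.
  + apply: (measurableT_comp (@abse_measurable R setT)).
    exact: measurable_funS mw.
  + by apply: filterS ae_inv_prod => y ->.
apply: filterS ae_weights_pos => x [a a0 va].
rewrite (eq_bigr (fun i => (a i)^-1%:E)); last first.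
  by move=> i _; rewrite va inver gt_eqF.
by rewrite prodEFin ltry lte_fin prodr_gt0// => i _; rewrite invr_gt0.
Qed.

(** The inverse of the weight [v i], cut off outside of [B], as a real-valued
function on the whole space. *)
Definition trunc_inv (B : set (Rn R n)) (i : 'I_m) (x : Rn R n) : R :=
  (fine (v i x)^-1 * \1_B x)%R.

Lemma measurable_trunc_inv (B : set (Rn R n)) i :
  measurable B -> measurable_fun setT (trunc_inv B i).
Proof.
move=> mB; apply: measurable_funM; last exact: measurable_indic.
exact: (measurableT_comp (@fine_measurable R setT measurableT) (mvV i)).
Qed.

Lemma ae_prod_trunc_inv (B : set (Rn R n)) : (0 < m)%N -> {ae mu, forall x,
  ((fun y => \prod_(i < m) (v i y)^-1) \_ B) x = (\prod_i trunc_inv B i x)%R%:E}.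
Proof.
move=> m0; apply: filterS ae_weights_pos => x [a a0 va].
rewrite /trunc_inv patchE indicE; case: ifPn => xB.
  rewrite -prodEFin; apply: eq_bigr => i _.
  by rewrite va inver gt_eqF// mulr1.
by rewrite (bigD1 (Ordinal m0))//= mulr0 mul0r.
Qed.

Lemma ae_prod_trunc_inv_in (B : set (Rn R n)) : (0 < m)%N ->
  {ae mu, forall x, B x ->
    \prod_(i < m) (v i x)^-1 = (\prod_i trunc_inv B i x)%R%:E}.
Proof.
move=> m0; apply: filterS (ae_prod_trunc_inv B m0) => x + xB.
by rewrite patchE mem_set.
Qed.

(** The left-hand sides of the reverse Hoelder inequalities of finite and
infinite exponent [t] are both [|B|^(-1/t)] times an [L^t] norm. *)
Lemma RH_lhsE (B : set (Rn R n)) (b : R) (t : \bar R) :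
  (0 < m)%N -> measurable B -> (0 < b)%R -> mu B = b%:E -> 0 < t ->
  (if t is s%:E
   then ((mu B)^-1 * \int[mu]_(y in B) ((\prod_(i < m) (v i y)^-1) `^ s)) `^ s^-1
   else ess_sup mu ((fun y => \prod_(i < m) (v i y)^-1) \_ B)) =
  (b `^ (- fine t^-1))%R%:E *
    Lnorm mu t (EFin \o (fun x => \prod_i trunc_inv B i x)%R).
Proof.
move=> m0 mB b0 Bb; rewrite Lnorm.unlock; case: t => [s|_|//].
  rewrite lte_fin => s0.
  have -> : \int[mu]_(y in B) ((\prod_(i < m) (v i y)^-1) `^ s) =
    \int[mu]_x (`|(EFin \o (fun x => \prod_i trunc_inv B i x)%R) x| `^ s).
    rewrite [RHS](_ : _ =
      \int[mu]_(x in B) ((`|\prod_i trunc_inv B i x| `^ s)%R%:E)).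
      apply: (ae_eq_integral _ _ mB).
      - apply: (measurableT_comp (measurable_poweR s)).
        exact: measurable_funS measurable_prod_inv.
      - apply/measurable_EFinP; apply: (measurableT_comp (measurable_powR s)).
        apply: (measurableT_comp (@normr_measurable R setT)).
        apply: measurable_prod => i _.
        exact: measurable_funS (measurable_trunc_inv B i mB).
      have tr0 : {ae mu, forall x, forall i, (0 <= trunc_inv B i x)%R}.
        apply: filterS ae_weights_pos => y [a a0 va] j.
        by rewrite /trunc_inv va inver gt_eqF//= mulr_ge0// invr_ge0 ltW.
      have := ae_prod_trunc_inv_in B m0.
      apply: filterS2 tr0 => x tr uB xB.
      by rewrite uB// poweR_EFin ger0_norm// prodr_ge0.
    rewrite [RHS]integral_mkcond; apply: eq_integral => x _.
    rewrite patchE; case: ifPn => // xB.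
    rewrite /= (bigD1 (Ordinal m0))//= /trunc_inv indicE (negPf xB) mulr0 mul0r.
    by rewrite normr0 powR0// gt_eqF.
  rewrite poweRM ?integral_ge0//; last 2 first.
  - by rewrite inve_ge0.
  - by move=> x _; exact: poweR_ge0.
  congr (_ * _); rewrite Bb !inver !gt_eqF// poweR_EFin /=.
  by rewrite -(powR_inv1 (ltW b0)) -powRrM mulN1r.
rewrite invey oppr0 powRr0 mul1e ifT; last first.
  apply: lt_le_trans (_ : mu B <= _); first by rewrite Bb.
  by apply: le_measure; rewrite ?inE.
apply: eq_ess_sup; apply: filterS2 (ae_prod_trunc_inv B m0) ae_weights_pos.
move=> x -> [a a0 va]; rewrite /= ger0_norm// prodr_ge0// => i _.
by rewrite /trunc_inv va inver gt_eqF//= mulr_ge0// invr_ge0 ltW.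
Qed.

(** The function whose norm appears in the condition on [v], attached to the
ball of centre [x] and radius [r], with arbitrary exponents [e]. *)
Definition weighted_kernel (e : 'I_m -> R) (x : Rn R n) (r : R) i (y : Rn R n) :=
  (v i y)^-1 /
    (mu (eball x r) `^ n%:R^-1 + (Defs.edist x y)%:E) `^ e i.

Lemma measurable_weighted_kernel e x r i :
  measurable_fun setT (weighted_kernel e x r i).
Proof.
apply: emeasurable_funM.
  by apply: (measurableT_comp (@measurable_inve R)); case: (wv i) => -[].
apply: (measurableT_comp (@measurable_inve R)).
apply: (measurableT_comp (measurable_poweR (e i))).
apply: emeasurable_funD; first exact: measurable_cst.
by apply/measurable_EFinP; exact: measurable_edist.
Qed.

(** On the ball, [b^(1/n) + |x - y|] is between [b^(1/n)] and
[(1 + n) b^(1/n)]. *)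
Lemma trunc_inv_le_kernel e x r b i : (0 < b)%R ->
  mu (eball x r) = b%:E -> (r <= n%:R * b `^ n%:R^-1)%R ->
  {ae mu, forall y, `|(trunc_inv (eball x r) i y)%:E| <=
    `|((1 + n%:R) `^ `|e i| * b `^ (e i / n%:R))%R%:E *
      weighted_kernel e x r i y|}.
Proof.
move=> b0 Bb rb; apply: filterS ae_weights_pos => y [a a0 va].
rewrite /trunc_inv indicE; case: (boolP (y \in eball x r)) => [|_]; last first.
  by rewrite mulr0 abse0 abse_ge0.
rewrite inE mulr1 => xy.
set K := (_ * _ `^ _)%R; set z := (b `^ n%:R^-1 + Defs.edist x y)%R.
have be0 : (0 < b `^ n%:R^-1)%R by exact: powR_gt0.
have z0 : (0 < z)%R by rewrite ltr_pwDl// edist_ge0.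
have zK : (z `^ e i <= K)%R.
  rewrite /K [(e i / _)%R]mulrC powRrM; apply: powR_le_scale => //.
    rewrite /z lerDl edist_ge0/= mulrDl mul1r lerD2l (le_trans _ rb)//.
    exact: ltW.
  by rewrite lerDl.
have zi : (0 < z `^ e i)%R by exact: powR_gt0.
rewrite /weighted_kernel va Bb inver gt_eqF//.
have -> : b%:E `^ n%:R^-1 + (Defs.edist x y)%:E = z%:E by [].
rewrite poweR_EFin.
rewrite inver gt_eqF// -!EFinM/= lee_fin.
have ai : (0 < (a i)^-1)%R by rewrite invr_gt0.
rewrite !ger0_norm ?mulr_ge0 ?invr_ge0 ?(ltW ai) ?(ltW (a0 i)) ?powR_ge0
  ?(le_trans _ zK) ?(ltW zi)//.
by rewrite mulrCA ler_peMr ?(ltW ai)// ler_pdivlMr// mul1r.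
Qed.

Lemma Lnorm_prod_trunc_inv_le e x r b (q : 'I_m -> \bar R) t :
  (0 < b)%R ->
  mu (eball x r) = b%:E -> (r <= n%:R * b `^ n%:R^-1)%R ->
  (forall i, 0 < q i) -> \sum_i (q i)^-1 = t^-1 ->
  Lnorm mu t (EFin \o (fun y => \prod_i trunc_inv (eball x r) i y)%R) <=
  (\prod_i ((1 + n%:R) `^ `|e i|) * b `^ ((\sum_i e i) / n%:R))%R%:E *
  \prod_i Lnorm mu (q i) (weighted_kernel e x r i).
Proof.
move=> b0 Bb rb q0 qt.
have mB := measurable_eball x r.
have mtr i : measurable_fun setT (trunc_inv (eball x r) i).
  exact: measurable_trunc_inv.
apply: le_trans (Lnorm_prod_le _ _ _ _ _ _ q t mtr q0 qt) _.
pose K i := ((1 + n%:R) `^ `|e i| * b `^ (e i / n%:R))%R.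
have K0 i : (0 < K i)%R by rewrite mulr_gt0 ?powR_gt0// ltr_pwDl.
have -> : (\prod_i ((1 + n%:R) `^ `|e i|) * b `^ ((\sum_i e i) / n%:R) =
    \prod_i K i)%R.
  rewrite big_split/=; congr (_ * _)%R; rewrite mulr_suml.
  elim/big_rec2: _ => [|i y s _ <-]; first by rewrite powRr0.
  by rewrite powRD// (gt_eqF b0) implybT.
rewrite -prodEFin -big_split/=.
apply: lee_prod_ge0 => i; rewrite Lnorm_ge0/=.
have mk := measurable_weighted_kernel e x r i.
rewrite -(Lnorm_pZl _ _ _ (leb R n) (q i) (K i) _ (q0 i) (K0 i) mk).
apply: (le_Lnorm _ _ _ (leb R n) (q i) _ _ (q0 i)).
- by apply/measurable_EFinP; exact: mtr.
- exact: measurable_funeM.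
- exact: (trunc_inv_le_kernel e x r b i b0 Bb rb).
Qed.

End weights_on_a_ball.

(** * The reverse Hoelder inequality *)

Theorem corollary1p4 (R : realType) (n m : nat) (delta beta : R)
    (p : 'I_m -> \bar R) (v : 'I_m -> Rn R n -> \bar R)
    (ptot := total_exponent p)
    (xi := ptot / (m%:R%:E * ptot - 1)) :
  (0 < n)%N ->
  (0 < beta < m%:R * n%:R)%R ->
  (forall i, 1 <= p i) ->
  Hvec delta p beta (beta - fine (n%:R%:E / ptot))%R v ->
  1 < xi ->
  RH xi (fun x => \prod_(i < m) (v i x)^-1).
Proof.
move=> n0 /andP[beta0 betamn] p1 [_ wv iw [b [_ sumb [C [C0 HC]]]]] xi1.
have m0 : (0 < m)%N.
  rewrite lt0n; apply/eqP => m_0.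
  by move: (lt_trans beta0 betamn); rewrite m_0 mul0r ltxx.
have n0R : (0 < n%:R :> R)%R by rewrite ltr0n.
have m0R : (0 < m%:R :> R)%R by rewrite ltr0n.
have [S S0m pS] := sum_inv_exponents p p1.
have [S0 ptotE xiV] := inv_xi p S pS S0m xi1.
have xi0 : 0 < xi by exact: lt_trans xi1.
pose q i := hoelder_conjugate (p i).
have q0 i : 0 < q i by apply: lt_le_trans (hoelder_conj_ge1 (p1 i)).
have qxi : \sum_i (q i)^-1 = xi^-1.
  by rewrite (sum_inv_conjugates p p1 S pS) -xiV.
have nptot : fine (n%:R%:E / ptot) = (n%:R * S)%R.
  by rewrite /ptot ptotE inver invr_eq0 gt_eqF// invrK.
split; first exact: is_weight_prod_inv.
pose e i := (n%:R - b i + delta / m%:R)%R.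
pose D := (\prod_i ((1 + n%:R) `^ `|e i|))%R.
have D0 : (0 < D)%R by apply: prodr_gt0 => i _; rewrite powR_gt0// ltr_pwDl.
exists (C * D)%R; split; first exact: mulr_gt0.
move=> x r r0; lazy zeta; set B := eball x r.
have [a [a0 Ba ra]] := leb_eball_fin x r n0 r0.
have mB : measurable B by exact: measurable_eball.
rewrite (RH_lhsE v wv B a xi m0 mB)//.
have := HC x r r0; lazy zeta; rewrite -/B.
set N := \prod_(i < m) _; set W := \int[leb R n]_(y in B) _.
move=> HB.
have ae_u := ae_weights_pos v wv.
have -> : \int[leb R n]_(y in B) \prod_(i < m) (v i y)^-1 = W.
  apply: (ae_eq_integral _ _ mB).
  - exact: measurable_funS (measurable_prod_inv v wv).
  - exact: measurable_funS iw.1.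
  - by apply: filterS (ae_inv_prod v wv) => y ->.
have W0 : 0 <= W.
  apply: (ae_integral_ge0 _ _ _ (leb R n) B _ mB).
    exact: measurable_funS iw.1.
  apply: filterS ae_u => y [w w0 vw]; rewrite inve_ge0.
  by apply: prode_ge0 => i _; rewrite vw lee_fin ltW.
have N0 : 0 <= N by apply: prode_ge0 => i _; exact: Lnorm_ge0.
have LN : Lnorm (leb R n) xi
    (EFin \o (fun y => \prod_i trunc_inv v B i y)%R) <=
    (D * a `^ ((\sum_i e i) / n%:R))%R%:E * N.
  exact: (Lnorm_prod_trunc_inv_le v wv e x r a q xi a0 Ba ra q0 qxi).
move: HB; rewrite Ba nptot poweR_EFin => HB.
have {HB} NW := le_of_ratio_le _ _ _ _ _ (powR_gt0 _ a0) C0 W0 N0 HB.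
rewrite xiV /=.
apply: (le_trans (lee_wpmul2l _ (le_trans LN (lee_wpmul2l _ NW)))).
- by rewrite lee_fin powR_ge0.
- by rewrite lee_fin mulr_ge0 ?powR_ge0 ?ltW.
(* Both sides are now real multiples of [W], and these agree: it remains to add
   up the powers of the measure [a] of the ball. *)
rewrite inver gt_eqF// !muleA -!EFinM lee_wpmul2r// lee_fin le_eqVlt.
apply/orP; left; apply/eqP.
have sume : (\sum_i e i = m%:R * n%:R - beta + delta)%R.
  rewrite big_split/= sumrB sumb !sumr_const card_ord -[(delta / _ *+ _)%R]mulr_natr.
  by rewrite divfK ?gt_eqF// -[(n%:R *+ m)%R]mulr_natl.
have aD s s' : (a `^ s * a `^ s' = a `^ (s + s'))%R.
  by rewrite powRD// (gt_eqF a0) implybT.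
rewrite -(powRN a (1 + _)) -(powR_inv1 (ltW a0)).
transitivity (C * D * (a `^ (- (m%:R - S)) * a `^ ((\sum_i e i) / n%:R) *
   a `^ (- (1 + (delta - (beta - n%:R * S)) / n%:R))))%R; first by ring.
rewrite !aD sume; congr (_ * a `^ _)%R.
by field; rewrite gt_eqF.
Qed.
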